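(* Let $\mathbf{K}$ be a monoidal triangulated category. The following are equivalent: (a) The universal support datum $V : \mathbf{K} \to \mathcal{X}(\operatorname{Spc} \mathbf{K})$ has the tensor product property $$V(A \otimes B) = V(A) \cap V(B) \quad \text{for all } A, B \in \mathbf{K}.$$ (b) Every prime ideal of $\mathbf{K}$ is completely prime.
   Context: A monoidal triangulated category is a monoidal category $\mathbf{K}$ which is triangulated and for which $\otimes : \mathbf{K} \times \mathbf{K} \to \mathbf{K}$ is an exact bifunctor. A thick subcategory is a full triangulated subcategory containing all direct summands of its objects. A thick two-sided ideal is a thick subcategory closed under left and right tensoring with arbitrary objects of $\mathbf{K}$. A prime ideal of $\mathbf{K}$ is a proper thick two-sided ideal $\mathbf{P}$ such that for all thick two-sided ideals $\mathbf{I}, \mathbf{J}$ of $\mathbf{K}$, $\mathbf{I} \otimes \mathbf{J} \subseteq \mathbf{P}$ implies $\mathbf{I} \subseteq \mathbf{P}$ or $\mathbf{J} \subseteq \mathbf{P}$, where $\mathbf{I}\otimes\mathbf{J}$ is the collection of objects $A \otimes B$ with $A\in\mathbf{I}$, $B\in\mathbf{J}$. (Equivalently: for all $A,B\in\mathbf{K}$, if $A \otimes C \otimes B \in \mathbf{P}$ for all $C \in \mathbf{K}$, then $A \in \mathbf{P}$ or $B \in \mathbf{P}$.) A proper thick two-sided ideal $\mathbf{P}$ is completely prime if for all objects $A, B$ of $\mathbf{K}$, $A \otimes B \in \mathbf{P}$ implies $A \in \mathbf{P}$ or $B \in \mathbf{P}$. The noncommutative Balmer spectrum $\operatorname{Spc}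 \mathbf{K}$ is the set of prime ideals of $\mathbf{K}$, with the topology generated by the closed sets $V(M) = \{ \mathbf{P} \in \operatorname{Spc} \mathbf{K} \mid M \notin \mathbf{P}\}$, $M \in \mathbf{K}$. The universal support datum is the map $M \mapsto V(M)$. $\mathcal{X}(Y)$ denotes the collection of all subsets of $Y$. *)

(* Defs.v *)
From HB Require Import structures.
From mathcomp Require Import all_boot all_algebra.
From mathcomp Require Import boolp classical_sets topology.

Set Implicit Arguments.
Unset Strict Implicit.
Unset Printing Implicit Defensive.

Import GRing.Theory.

Local Open Scope ring_scope.
Local Open Scope classical_set_scope.

Declare Scope cat_scope.
Delimit Scope cat_scope with cat.
Local Open Scope cat_scope.

Reserved Notation "g ∘ f" (at level 40, left associativity).
Reserved Notation "A ⊗ B" (at level 40, left associativity).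

Record preadditive := Preadditive {
  obj :> Type;
  hom : obj -> obj -> zmodType;
  idm : forall A, hom A A;
  comp : forall A B C, hom B C -> hom A B -> hom A C;
  comp_idl : forall A B (f : hom A B), comp (idm B) f = f;
  comp_idr : forall A B (f : hom A B), comp f (idm A) = f;
  compA : forall A B C D (h : hom C D) (g : hom B C) (f : hom A B),
    comp h (comp g f) = comp (comp h g) f;
  compDl : forall A B C (g g' : hom B C) (f : hom A B),
    comp (g + g') f = comp g f + comp g' f;
  compDr : forall A B C (g : hom B C) (f f' : hom A B),
    comp g (f + f') = comp g f + comp g f' }.

Arguments hom {p} A B : rename.
Arguments idm {p} A : rename.
Notation "g ∘ f" := (comp g f) : cat_scope.

Definition is_iso (C : preadditive) (A B : C) (f : hom A B) : Prop :=
  exists g : hom B A, g ∘ f = idm A /\ f ∘ g = idm B.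

Definition isomorphic (C : preadditive) (A B : C) : Prop :=
  exists f : hom A B, is_iso f.

Definition is_zero_object (C : preadditive) (Z : C) : Prop :=
  forall A : C, (forall f : hom A Z, f = 0) /\ (forall f : hom Z A, f = 0).

Definition is_biproduct (C : preadditive) (A B S : C) : Prop :=
  exists (iA : hom A S) (iB : hom B S) (pA : hom S A) (pB : hom S B),
    [/\ pA ∘ iA = idm A, pB ∘ iB = idm B, pA ∘ iB = 0, pB ∘ iA = 0 &
        iA ∘ pA + iB ∘ pB = idm S].

Definition direct_summand (C : preadditive) (A S : C) : Prop :=
  exists B : C, is_biproduct A B S.

Definition is_additive (C : preadditive) : Prop :=
  (exists Z : C, is_zero_object Z) /\
  (forall A B : C, exists S : C, is_biproduct A B S).

Record functor (C D : preadditive) := Functor {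
  fobj :> C -> D;
  fmap : forall A B : C, hom A B -> hom (fobj A) (fobj B);
  fmap_id : forall A, fmap (idm A) = idm (fobj A);
  fmap_comp : forall (A B E : C) (g : hom B E) (f : hom A B),
    fmap (g ∘ f) = fmap g ∘ fmap f }.

Arguments fmap {C D} F {A B} f : rename.

Definition additive_functor (C D : preadditive) (F : functor C D) : Prop :=
  forall (A B : C) (f g : hom A B), fmap F (f + g) = fmap F f + fmap F g.

Definition id_functor (C : preadditive) : functor C C :=
  @Functor C C id (fun _ _ => id) (fun _ => erefl) (fun _ _ _ _ _ => erefl).

Section CompFunctor.
Variables (C D E : preadditive) (G : functor D E) (F : functor C D).

Let map (A B : C) (f : hom A B) : hom (G (F A)) (G (F B)) :=
  fmap G (fmap F f).

Fact comp_functor_id (A : C) : map (idm A) = idm (G (F A)).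
Proof. by rewrite /map !fmap_id. Qed.

Fact comp_functor_comp (A B B' : C) (g : hom B B') (f : hom A B) :
  map (g ∘ f) = map g ∘ map f.
Proof. by rewrite /map !fmap_comp. Qed.

Definition comp_functor : functor C E :=
  Functor comp_functor_id comp_functor_comp.
End CompFunctor.

Record nat_iso (C D : preadditive) (F G : functor C D) := NatIso {
  nt :> forall A : C, hom (F A) (G A);
  nt_natural : forall (A B : C) (f : hom A B), fmap G f ∘ nt A = nt B ∘ fmap F f;
  nt_iso : forall A : C, is_iso (nt A) }.

Definition is_equivalence (C D : preadditive) (F : functor C D) : Prop :=
  exists G : functor D C,
    inhabited (nat_iso (comp_functor G F) (id_functor C)) /\
    inhabited (nat_iso (comp_functor F G) (id_functor D)).

(* Verdier's axioms; [dist f g h] says that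
   X --f--> Y --g--> Z --h--> Sigma X is a distinguished triangle.
   The suspension is only required to be an autoequivalence. *)
Record triangulated := Triangulated {
  tri_cat :> preadditive;
  tri_additive : is_additive tri_cat;
  Sigma : functor tri_cat tri_cat;
  Sigma_additive : additive_functor Sigma;
  Sigma_equiv : is_equivalence Sigma;
  dist : forall X Y Z : tri_cat,
    hom X Y -> hom Y Z -> hom Z (Sigma X) -> Prop;
  TR1_iso : forall (X Y Z X' Y' Z' : tri_cat)
      (f : hom X Y) (g : hom Y Z) (h : hom Z (Sigma X))
      (f' : hom X' Y') (g' : hom Y' Z') (h' : hom Z' (Sigma X'))
      (a : hom X X') (b : hom Y Y') (c : hom Z Z'),
    is_iso a -> is_iso b -> is_iso c ->
    b ∘ f = f' ∘ a -> c ∘ g = g' ∘ b -> fmap Sigma a ∘ h = h' ∘ c ->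
    dist f g h -> dist f' g' h';
  TR1_id : forall X Z : tri_cat, is_zero_object Z ->
    dist (idm X) (0 : hom X Z) (0 : hom Z (Sigma X));
  TR1_cone : forall (X Y : tri_cat) (f : hom X Y),
    exists (Z : tri_cat) (g : hom Y Z) (h : hom Z (Sigma X)), dist f g h;
  TR2 : forall (X Y Z : tri_cat)
      (f : hom X Y) (g : hom Y Z) (h : hom Z (Sigma X)),
    dist f g h <-> dist g h (- fmap Sigma f);
  TR3 : forall (X Y Z X' Y' Z' : tri_cat)
      (f : hom X Y) (g : hom Y Z) (h : hom Z (Sigma X))
      (f' : hom X' Y') (g' : hom Y' Z') (h' : hom Z' (Sigma X'))
      (a : hom X X') (b : hom Y Y'),
    dist f g h -> dist f' g' h' -> b ∘ f = f' ∘ a ->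
    exists c : hom Z Z', c ∘ g = g' ∘ b /\ fmap Sigma a ∘ h = h' ∘ c;
  TR4 : forall (X Y Z X' Y' Z' : tri_cat)
      (f : hom X Y) (g : hom Y Z)
      (u : hom Y Z') (v : hom Z' (Sigma X))
      (s : hom Z X') (t : hom X' (Sigma Y))
      (k : hom Z Y') (l : hom Y' (Sigma X)),
    dist f u v -> dist g s t -> dist (g ∘ f) k l ->
    exists (a : hom Z' Y') (b : hom Y' X'),
      dist a b (fmap Sigma u ∘ t) /\
      [/\ a ∘ u = k ∘ g, l ∘ a = v, b ∘ k = s & t ∘ b = fmap Sigma f ∘ l] }.

Arguments Sigma {t} : rename.
Arguments dist {t X Y Z} f g h : rename.

Definition exact_functor (T T' : triangulated) (F : functor T T') : Prop :=
  additive_functor F /\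
  exists phi : nat_iso (comp_functor F Sigma) (comp_functor Sigma F),
    forall (X Y Z : T) (f : hom X Y) (g : hom Y Z) (h : hom Z (Sigma X)),
      dist f g h -> dist (fmap F f) (fmap F g) (phi X ∘ fmap F h).

Record monoidal_structure (C : preadditive) := MonoidalStructure {
  tensor_obj : C -> C -> C;
  tensor_map : forall A A' B B' : C, hom A A' -> hom B B' ->
    hom (tensor_obj A B) (tensor_obj A' B');
  tensor_id : forall A B : C,
    tensor_map (idm A) (idm B) = idm (tensor_obj A B);
  tensor_comp : forall (A A' A'' B B' B'' : C)
      (f' : hom A' A'') (f : hom A A') (g' : hom B' B'') (g : hom B B'),
    tensor_map (f' ∘ f) (g' ∘ g) = tensor_map f' g' ∘ tensor_map f g;
  tensor_unit : C;
  associator : forall A B D : C,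
    hom (tensor_obj (tensor_obj A B) D) (tensor_obj A (tensor_obj B D));
  left_unitor : forall A : C, hom (tensor_obj tensor_unit A) A;
  right_unitor : forall A : C, hom (tensor_obj A tensor_unit) A;
  associator_iso : forall A B D, is_iso (associator A B D);
  left_unitor_iso : forall A, is_iso (left_unitor A);
  right_unitor_iso : forall A, is_iso (right_unitor A);
  associator_natural : forall (A A' B B' D D' : C)
      (f : hom A A') (g : hom B B') (h : hom D D'),
    associator A' B' D' ∘ tensor_map (tensor_map f g) h =
    tensor_map f (tensor_map g h) ∘ associator A B D;
  left_unitor_natural : forall (A A' : C) (f : hom A A'),
    left_unitor A' ∘ tensor_map (idm tensor_unit) f = f ∘ left_unitor A;
  right_unitor_natural : forall (A A' : C) (f : hom A A'),
    right_unitor A' ∘ tensor_map f (idm tensor_unit) = f ∘ right_unitor A;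
  pentagon : forall A B D E : C,
    associator A B (tensor_obj D E) ∘ associator (tensor_obj A B) D E =
    tensor_map (idm A) (associator B D E) ∘
      associator A (tensor_obj B D) E ∘
      tensor_map (associator A B D) (idm E);
  triangle : forall A B : C,
    tensor_map (idm A) (left_unitor B) ∘ associator A tensor_unit B =
    tensor_map (right_unitor A) (idm B) }.

Section TensorFunctors.
Variables (C : preadditive) (M : monoidal_structure C) (A : C).

Fact tensor_left_id (B : C) :
  tensor_map M (idm A) (idm B) = idm (tensor_obj M A B).
Proof. exact: tensor_id. Qed.

Fact tensor_left_comp (B B' B'' : C) (g : hom B' B'') (f : hom B B') :
  tensor_map M (idm A) (g ∘ f) =
  tensor_map M (idm A) g ∘ tensor_map M (idm A) f.
Proof. by rewrite -tensor_comp comp_idl. Qed.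

Definition tensor_left : functor C C :=
  @Functor C C (fun B => tensor_obj M A B)
    (fun _ _ f => tensor_map M (idm A) f) tensor_left_id tensor_left_comp.

Fact tensor_right_id (B : C) :
  tensor_map M (idm B) (idm A) = idm (tensor_obj M B A).
Proof. exact: tensor_id. Qed.

Fact tensor_right_comp (B B' B'' : C) (g : hom B' B'') (f : hom B B') :
  tensor_map M (g ∘ f) (idm A) =
  tensor_map M g (idm A) ∘ tensor_map M f (idm A).
Proof. by rewrite -tensor_comp comp_idl. Qed.

Definition tensor_right : functor C C :=
  @Functor C C (fun B => tensor_obj M B A)
    (fun _ _ f => tensor_map M f (idm A)) tensor_right_id tensor_right_comp.
End TensorFunctors.

(* "Exact bifunctor" means exact in each variable; no compatibility between the
   two suspension isomorphisms is imposed. *)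
Record monoidal_triangulated := MonoidalTriangulated {
  mt_tri :> triangulated;
  mt_monoidal : monoidal_structure mt_tri;
  mt_exact_left : forall A : mt_tri,
    exact_functor (tensor_left mt_monoidal A : functor mt_tri mt_tri);
  mt_exact_right : forall A : mt_tri,
    exact_functor (tensor_right mt_monoidal A : functor mt_tri mt_tri) }.

Notation "A ⊗ B" := (tensor_obj (mt_monoidal _) A B) : cat_scope.

(* Full subcategories are given by their sets of objects. *)
Record triangulated_subcategory (T : triangulated) (S : set T) : Prop := {
  tsub_zero : forall Z : T, is_zero_object Z -> S Z;
  tsub_biproduct : forall A B D : T, is_biproduct A B D -> S A -> S B -> S D;
  tsub_iso : forall A B : T, isomorphic A B -> S A -> S B;
  tsub_Sigma : forall A : T, S (Sigma A) <-> S A;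
  tsub_cone : forall (X Y Z : T)
      (f : hom X Y) (g : hom Y Z) (h : hom Z (Sigma X)),
    dist f g h -> S X -> S Y -> S Z }.

Definition thick_subcategory (T : triangulated) (S : set T) : Prop :=
  triangulated_subcategory S /\
  forall A B : T, direct_summand A B -> S B -> S A.

Section Spectrum.
Variable K : monoidal_triangulated.
Implicit Types I J P : set K.

Definition thick_ideal I : Prop :=
  thick_subcategory I /\
  forall A B : K, I A -> I (A ⊗ B) /\ I (B ⊗ A).

Definition tensor_set I J : set K := [set A ⊗ B | A in I & B in J].

Definition proper_thick_ideal P : Prop := thick_ideal P /\ P <> [set: K].

Definition prime_ideal P : Prop :=
  proper_thick_ideal P /\
  forall I J, thick_ideal I -> thick_ideal J ->
    tensor_set I J `<=` P -> I `<=` P \/ J `<=` P.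

Definition completely_prime P : Prop :=
  proper_thick_ideal P /\
  forall A B : K, P (A ⊗ B) -> P A \/ P B.

Record Spc := MkSpc {
  spc_ideal :> set K;
  spc_prime : prime_ideal spc_ideal }.

(* the universal support datum *)
Definition V (M : K) : set Spc := [set P : Spc | ~ (P : set K) M].

HB.instance Definition _ := gen_eqMixin Spc.
HB.instance Definition _ := gen_choiceMixin Spc.

(* The V(M) form a subbase of closed sets: the complements ~` V M form a
   subbase of open sets. *)
HB.instance Definition _ := isSubBaseTopological.Build Spc
  (I := set Spc) [set ~` V M | M in [set: K]] id.

End Spectrum.

Arguments V {K} M.

(* Main.v *)
Require Import Defs.
From mathcomp Require Import all_boot all_algebra.
From mathcomp Require Import boolp classical_sets topology.
Local Open Scope classical_set_scope.
Local Open Scope cat_scope.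

(** Membership of a point [P] in [V M] means [M] is not in [P], so the
    tensor product property, read at the point [P] and contraposed, is the
    equivalence: [A ⊗ B] lies in [P] iff [A] or [B] does.  One direction,
    [V_tensor_subset], holds at every [P] because [P] absorbs tensor products
    on either side; the other is complete primeness of [P].  The points of the
    spectrum are exactly the prime ideals, so quantifying over [P] gives the
    theorem. *)

Lemma V_tensor_subset (K : monoidal_triangulated) (A B : K) :
  V (A ⊗ B) `<=` V A `&` V B.
Proof.
move=> P nPAB; have [[[_ absorb] _] _] := spc_prime P.
split=> [PA | PB]; apply: nPAB.
- by have [] := absorb A B PA.
- by have [] := absorb B A PB.
Qed.

Theorem theorem3p1p1 (K : monoidal_triangulated) :
  (forall A B : K, V (A ⊗ B) = V A `&` V B) <->
  (forall P : set K, prime_ideal P -> completely_prime P).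
Proof.
split=> [V_tensor P primeP | prime_cp A B].
  split; first exact: primeP.1.
  move=> A B PAB; apply: contrapT => /not_orP nPAPB.
  have : (V A `&` V B) (MkSpc primeP) by [].
  by rewrite -V_tensor; apply.
apply/seteqP; split; first exact: V_tensor_subset.
move=> P [nPA nPB] PAB.
by have [_ /(_ _ _ PAB)[]] := prime_cp _ (spc_prime P).
Qed.
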